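(* (1) An s-hypersequent $\alpha_1\vdash\beta_1\mid\dots\mid\alpha_n\vdash\beta_n$ is provable in $\mathbf{MPDBL}$ if and only if it is valid in the class of all pure double Boolean algebras with operators. (2) An s-hypersequent $\alpha_1\vdash\beta_1\mid\dots\mid\alpha_n\vdash\beta_n$ is provable in $\mathbf{MPDBL4}$ if and only if it is valid in the class of all topological pure double Boolean algebras.
   Context: Pure double Boolean algebras. A double Boolean algebra is an algebra $\mathbf{D}=(D,\sqcup,\sqcap,\neg,\lrcorner,\top,\bot)$ such that, writing $x\vee y:=\neg(\neg x\sqcap\neg y)$ and $x\wedge y:=\lrcorner(\lrcorner x\sqcup\lrcorner y)$, for all $x,y,z$: $(x\sqcap x)\sqcap y=x\sqcap y$; $(x\sqcup x)\sqcup y=x\sqcup y$; $\sqcap,\sqcup$ commutative and associative; $\neg(x\sqcap x)=\neg x$; $\lrcorner(x\sqcup x)=\lrcorner x$; $x\sqcap(x\sqcup y)=x\sqcap x$; $x\sqcup(x\sqcap y)=x\sqcup x$; $x\sqcap(y\vee z)=(x\sqcap y)\vee(x\sqcap z)$; $x\sqcup(y\wedge z)=(x\sqcup y)\wedge(x\sqcup z)$; $x\sqcap(x\vee y)=x\sqcap x$; $x\sqcup(x\wedge y)=x\sqcup x$; $\neg\neg(x\sqcap y)=x\sqcap y$; $\lrcorner\lrcorner(x\sqcup y)=x\sqcup y$; $x\sqcap\neg x=\bot$; $x\sqcup\lrcorner x=\top$; $\neg\bot=\top\sqcap\top$; $\lrcorner\top=\bot\sqcup\bot$; $\neg\top=\bot$;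 $\lrcorner\bot=\top$; $(x\sqcap x)\sqcup(x\sqcap x)=(x\sqcup x)\sqcap(x\sqcup x)$. It is pure (pdBa) if each $x$ satisfies $x\sqcap x=x$ or $x\sqcup x=x$. $D_\sqcap=\{x:x\sqcap x=x\}$, $D_\sqcup=\{x:x\sqcup x=x\}$; $x\sqsubseteq y$ iff $x\sqcap y=x\sqcap x$ and $x\sqcup y=y\sqcup y$. A pdBa with operators (pdBao) is a pdBa with two maps $\mathbf{I},\mathbf{C}:D\to D$, monotone w.r.t. $\sqsubseteq$, such that $\mathbf{I}(x\sqcap y)=\mathbf{I}(x)\sqcap\mathbf{I}(y)$, $\mathbf{C}(x\sqcup y)=\mathbf{C}(x)\sqcup\mathbf{C}(y)$, $\mathbf{I}(\neg\bot)=\neg\bot$, $\mathbf{C}(\lrcorner\top)=\lrcorner\top$, $\mathbf{I}(x\sqcap x)=\mathbf{I}(x)$, $\mathbf{C}(x\sqcup x)=\mathbf{C}(x)$. A topological pdBa (tpdBa) is a pdBao which moreover satisfies $\mathbf{I}(x)\sqsubseteq x$, $x\sqsubseteq\mathbf{C}(x)$, $\mathbf{I}\mathbf{I}(x)=\mathbf{I}(x)$, $\mathbf{C}\mathbf{C}(x)=\mathbf{C}(x)$ for all $x$. The logic PDBL. Variables: object variables $\mathbf{OV}$ ($p,\dots$) and property variables $\mathbf{PV}$ ($P,\dots$), disjoint countably infinite sets; constants $\top,\bot$; connectives $\sqcap,\sqcup$ (binary), $\neg,\lrcorner$ (unary). $\alpha\vee\beta:=\neg(\neg\alpha\sqcap\neg\beta)$,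 $\alpha\wedge\beta:=\lrcorner(\lrcorner\alpha\sqcup\lrcorner\beta)$. Sequents $\alpha\vdash\beta$ ($\alpha\dashv\vdash\beta$ means both directions); s-hypersequents are finite sequences $\alpha_1\vdash\beta_1\mid\dots\mid\alpha_n\vdash\beta_n$; $B,C,\dots,X$ range over possibly empty s-hypersequents. Axioms: $\alpha\vdash\alpha$; $\alpha\sqcap\beta\vdash\alpha$; $\alpha\sqcap\beta\vdash\beta$; $\alpha\vdash\alpha\sqcup\beta$; $\beta\vdash\alpha\sqcup\beta$; $\alpha\sqcap\beta\vdash(\alpha\sqcap\beta)\sqcap(\alpha\sqcap\beta)$; $(\alpha\sqcup\beta)\sqcup(\alpha\sqcup\beta)\vdash\alpha\sqcup\beta$; $\neg(\alpha\sqcap\alpha)\vdash\neg\alpha$; $\lrcorner\alpha\vdash\lrcorner(\alpha\sqcup\alpha)$; $\alpha\sqcap\neg\alpha\vdash\bot$; $\top\vdash\alpha\sqcup\lrcorner\alpha$; $\neg\neg(\alpha\sqcap\beta)\dashv\vdash\alpha\sqcap\beta$; $\lrcorner\lrcorner(\alpha\sqcup\beta)\dashv\vdash\alpha\sqcup\beta$; $\alpha\sqcap\alpha\vdash\alpha\sqcap(\alpha\sqcup\beta)$; $\alpha\sqcup(\alpha\sqcap\beta)\vdash\alpha\sqcup\alpha$; $\alpha\sqcap\alpha\vdash\alpha\sqcap(\alpha\vee\beta)$; $\alpha\sqcup(\alpha\wedge\beta)\vdash\alpha\sqcup\alpha$; $\alpha\sqcap(\beta\vee\gamma)\dashv\vdash(\alpha\sqcap\beta)\vee(\alpha\sqcap\gamma)$;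 $\alpha\sqcup(\beta\wedge\gamma)\dashv\vdash(\alpha\sqcup\beta)\wedge(\alpha\sqcup\gamma)$; $\bot\vdash\alpha$; $\alpha\vdash\top$; $\neg\top\vdash\bot$; $\top\vdash\lrcorner\bot$; $\neg\bot\dashv\vdash\top\sqcap\top$; $\lrcorner\top\dashv\vdash\bot\sqcup\bot$; $(\alpha\sqcup\alpha)\sqcap(\alpha\sqcup\alpha)\dashv\vdash(\alpha\sqcap\alpha)\sqcup(\alpha\sqcap\alpha)$; $p\sqcap p\dashv\vdash p$ ($p\in\mathbf{OV}$); $P\sqcup P\dashv\vdash P$ ($P\in\mathbf{PV}$); (Sp) $\alpha\vdash\alpha\sqcap\alpha\mid\alpha\sqcup\alpha\vdash\alpha$. Rules: from $B\mid\alpha\vdash\beta\mid C$ infer $B\mid\alpha\sqcap\gamma\vdash\beta\sqcap\gamma\mid C$, $B\mid\gamma\sqcap\alpha\vdash\gamma\sqcap\beta\mid C$, $B\mid\alpha\sqcup\gamma\vdash\beta\sqcup\gamma\mid C$, $B\mid\gamma\sqcup\alpha\vdash\gamma\sqcup\beta\mid C$, $B\mid\neg\beta\vdash\neg\alpha\mid C$, $B\mid\lrcorner\beta\vdash\lrcorner\alpha\mid C$; from $B\mid\alpha\vdash\beta\mid C$ and $D\mid\beta\vdash\gamma\mid E$ infer $B\mid D\mid\alpha\vdash\gamma\mid C\mid E$; from $B\mid\alpha\sqcap\beta\vdash\alpha\sqcap\alpha\mid C$, $D\mid\alpha\sqcap\alpha\vdash\alpha\sqcap\beta\mid E$, $F\mid\alpha\sqcup\beta\vdash\beta\sqcup\beta\mid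 G$, $H\mid\beta\sqcup\beta\vdash\alpha\sqcup\beta\mid X$ infer $B\mid D\mid F\mid H\mid\alpha\vdash\beta\mid C\mid E\mid G\mid X$; external: from $B\mid D\mid D\mid C$ infer $B\mid D\mid C$; from $B\mid D\mid E\mid C$ infer $B\mid E\mid D\mid C$; from $B$ infer $B\mid C$. MPDBL and MPDBL4. $\mathbf{MPDBL}$ adds unary connectives $\square,\blacksquare$ (all PDBL axiom schemes and rules range over the enlarged set of formulae), with additional axioms $\square\alpha\sqcap\square\beta\dashv\vdash\square(\alpha\sqcap\beta)$; $\blacksquare\alpha\sqcup\blacksquare\beta\dashv\vdash\blacksquare(\alpha\sqcup\beta)$; $\square(\neg\bot)\dashv\vdash\neg\bot$; $\blacksquare(\lrcorner\top)\dashv\vdash\lrcorner\top$; $\square(\alpha\sqcap\alpha)\dashv\vdash\square\alpha$; $\blacksquare(\alpha\sqcup\alpha)\dashv\vdash\blacksquare\alpha$, and rules: from $B\mid\alpha\vdash\beta\mid C$ infer $B\mid\square\alpha\vdash\square\beta\mid C$ and $B\mid\blacksquare\alpha\vdash\blacksquare\beta\mid C$. $\mathbf{MPDBL4}$ is $\mathbf{MPDBL}$ plus the axioms $\square\alpha\vdash\alpha$, $\alpha\vdash\blacksquare\alpha$, $\square\square\alpha\dashv\vdash\square\alpha$, $\blacksquare\blacksquare\alpha\dashv\vdash\blacksquare\alpha$. Provability is via finite derivations. Semantics. A valuation on a pdBao is a map $v$ with $v(p)\in D_\sqcap$, $v(P)\in D_\sqcup$, $v(\top)=\top$, $v(\bot)=\bot$,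 extended homomorphically, with $v(\square\alpha)=\mathbf{I}(v(\alpha))$, $v(\blacksquare\alpha)=\mathbf{C}(v(\alpha))$. $v$ satisfies $\alpha\vdash\beta$ iff $v(\alpha)\sqsubseteq v(\beta)$, and an s-hypersequent iff it satisfies some component; an s-hypersequent is true in an algebra if every valuation satisfies it and valid in a class if true in each member. *)

(* Defs.v *)
From Stdlib Require Import List.
Import ListNotations.

Reserved Notation "x ⊓ y" (at level 40, left associativity).
Reserved Notation "x ⊔ y" (at level 50, left associativity).
Reserved Notation "x ∨ y" (at level 50, left associativity).
Reserved Notation "x ∧ y" (at level 40, left associativity).
Reserved Notation "¬ x" (at level 35, right associativity).
Reserved Notation "⌟ x" (at level 35, right associativity).
Reserved Notation "□ x" (at level 35, right associativity).
Reserved Notation "■ x" (at level 35, right associativity).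
Reserved Notation "x ⊑ y" (at level 70, no associativity).
Reserved Notation "x ⊢ y" (at level 70, no associativity).

Record dBa_sig : Type := {
  carrier :> Type;
  cup : carrier -> carrier -> carrier;
  cap : carrier -> carrier -> carrier;
  neg : carrier -> carrier;
  lneg : carrier -> carrier;
  top : carrier;
  bot : carrier
}.

Arguments cup {_}.
Arguments cap {_}.
Arguments neg {_}.
Arguments lneg {_}.
Arguments top {_}.
Arguments bot {_}.

Declare Scope dba_scope.
Delimit Scope dba_scope with dba.
Notation "x ⊓ y" := (cap x y) : dba_scope.
Notation "x ⊔ y" := (cup x y) : dba_scope.
Notation "¬ x" := (neg x) : dba_scope.
Notation "⌟ x" := (lneg x) : dba_scope.
Notation "⊤" := top : dba_scope.
Notation "⊥" := bot : dba_scope.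

Definition vee {D : dBa_sig} (x y : D) : D := (¬ (¬ x ⊓ ¬ y))%dba.
Definition wedge {D : dBa_sig} (x y : D) : D := (⌟ (⌟ x ⊔ ⌟ y))%dba.
Notation "x ∨ y" := (vee x y) : dba_scope.
Notation "x ∧ y" := (wedge x y) : dba_scope.

Definition in_cap {D : dBa_sig} (x : D) : Prop := (x ⊓ x = x)%dba.
Definition in_cup {D : dBa_sig} (x : D) : Prop := (x ⊔ x = x)%dba.

Definition sqle {D : dBa_sig} (x y : D) : Prop :=
  (x ⊓ y = x ⊓ x /\ x ⊔ y = y ⊔ y)%dba.
Notation "x ⊑ y" := (sqle x y) : dba_scope.

Record is_dBa (D : dBa_sig) : Prop := {
  cap_idem_l : forall x y : D, ((x ⊓ x) ⊓ y = x ⊓ y)%dba;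
  cup_idem_l : forall x y : D, ((x ⊔ x) ⊔ y = x ⊔ y)%dba;
  cap_comm : forall x y : D, (x ⊓ y = y ⊓ x)%dba;
  cup_comm : forall x y : D, (x ⊔ y = y ⊔ x)%dba;
  cap_assoc : forall x y z : D, (x ⊓ (y ⊓ z) = (x ⊓ y) ⊓ z)%dba;
  cup_assoc : forall x y z : D, (x ⊔ (y ⊔ z) = (x ⊔ y) ⊔ z)%dba;
  neg_cap_idem : forall x : D, (¬ (x ⊓ x) = ¬ x)%dba;
  lneg_cup_idem : forall x : D, (⌟ (x ⊔ x) = ⌟ x)%dba;
  cap_cup_absorb : forall x y : D, (x ⊓ (x ⊔ y) = x ⊓ x)%dba;
  cup_cap_absorb : forall x y : D, (x ⊔ (x ⊓ y) = x ⊔ x)%dba;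
  cap_vee_distr : forall x y z : D, (x ⊓ (y ∨ z) = (x ⊓ y) ∨ (x ⊓ z))%dba;
  cup_wedge_distr : forall x y z : D, (x ⊔ (y ∧ z) = (x ⊔ y) ∧ (x ⊔ z))%dba;
  cap_vee_absorb : forall x y : D, (x ⊓ (x ∨ y) = x ⊓ x)%dba;
  cup_wedge_absorb : forall x y : D, (x ⊔ (x ∧ y) = x ⊔ x)%dba;
  negneg_cap : forall x y : D, (¬ ¬ (x ⊓ y) = x ⊓ y)%dba;
  lneglneg_cup : forall x y : D, (⌟ ⌟ (x ⊔ y) = x ⊔ y)%dba;
  cap_neg : forall x : D, (x ⊓ ¬ x = ⊥)%dba;
  cup_lneg : forall x : D, (x ⊔ ⌟ x = ⊤)%dba;
  neg_bot : (¬ ⊥ = ⊤ ⊓ ⊤ :> D)%dba;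
  lneg_top : (⌟ ⊤ = ⊥ ⊔ ⊥ :> D)%dba;
  neg_top : (¬ ⊤ = ⊥ :> D)%dba;
  lneg_bot : (⌟ ⊥ = ⊤ :> D)%dba;
  cap_cup_idem : forall x : D, ((x ⊓ x) ⊔ (x ⊓ x) = (x ⊔ x) ⊓ (x ⊔ x))%dba
}.

Record dBa : Type := {
  dBa_base :> dBa_sig;
  dBa_axioms : is_dBa dBa_base
}.

Record pdBa : Type := {
  pdBa_base :> dBa;
  pdBa_pure : forall x : pdBa_base, in_cap x \/ in_cup x
}.

Record pdBao : Type := {
  pdBao_base :> pdBa;
  opI : pdBao_base -> pdBao_base;
  opC : pdBao_base -> pdBao_base;
  opI_mono : forall x y : pdBao_base, (x ⊑ y)%dba -> (opI x ⊑ opI y)%dba;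
  opC_mono : forall x y : pdBao_base, (x ⊑ y)%dba -> (opC x ⊑ opC y)%dba;
  opI_cap : forall x y : pdBao_base, (opI (x ⊓ y) = opI x ⊓ opI y)%dba;
  opC_cup : forall x y : pdBao_base, (opC (x ⊔ y) = opC x ⊔ opC y)%dba;
  opI_neg_bot : (opI (¬ ⊥) = ¬ ⊥)%dba;
  opC_lneg_top : (opC (⌟ ⊤) = ⌟ ⊤)%dba;
  opI_cap_idem : forall x : pdBao_base, (opI (x ⊓ x) = opI x)%dba;
  opC_cup_idem : forall x : pdBao_base, (opC (x ⊔ x) = opC x)%dba
}.

Arguments opI {_}.
Arguments opC {_}.

(* Topological pdBas form a subclass of the pdBaos, hence a predicate rather than
   a further record. *)
Record topological (D : pdBao) : Prop := {
  opI_decr : forall x : D, (opI x ⊑ x)%dba;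
  opC_incr : forall x : D, (x ⊑ opC x)%dba;
  opI_idem : forall x : D, opI (opI x) = opI x;
  opC_idem : forall x : D, opC (opC x) = opC x
}.

Inductive form : Type :=
| OV (p : nat)
| PV (P : nat)
| FTop
| FBot
| FCap (a b : form)
| FCup (a b : form)
| FNeg (a : form)
| FLneg (a : form)
| FBox (a : form)
| FBlackbox (a : form).

Declare Scope form_scope.
Delimit Scope form_scope with form.
Bind Scope form_scope with form.
Notation "x ⊓ y" := (FCap x y) : form_scope.
Notation "x ⊔ y" := (FCup x y) : form_scope.
Notation "¬ x" := (FNeg x) : form_scope.
Notation "⌟ x" := (FLneg x) : form_scope.
Notation "□ x" := (FBox x) : form_scope.
Notation "■ x" := (FBlackbox x) : form_scope.
Notation "⊤" := FTop : form_scope.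
Notation "⊥" := FBot : form_scope.

Definition FVee (a b : form) : form := (¬ (¬ a ⊓ ¬ b))%form.
Definition FWedge (a b : form) : form := (⌟ (⌟ a ⊔ ⌟ b))%form.
Notation "x ∨ y" := (FVee x y) : form_scope.
Notation "x ∧ y" := (FWedge x y) : form_scope.

Record sequent : Type := Sequent { ant : form; suc : form }.
Notation "a ⊢ b" := (Sequent a%form b%form).

(* The bar of hypersequents is list concatenation. *)
Definition hypersequent : Type := list sequent.

(* Each scheme "a ⊣⊢ b" is split into its two directions. *)
Inductive PDBL : hypersequent -> Prop :=
| ax_refl a : PDBL [a ⊢ a]
| ax_cap_l a b : PDBL [a ⊓ b ⊢ a]
| ax_cap_r a b : PDBL [a ⊓ b ⊢ b]
| ax_cup_l a b : PDBL [a ⊢ a ⊔ b]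
| ax_cup_r a b : PDBL [b ⊢ a ⊔ b]
| ax_cap_dup a b : PDBL [a ⊓ b ⊢ (a ⊓ b) ⊓ (a ⊓ b)]
| ax_cup_dup a b : PDBL [(a ⊔ b) ⊔ (a ⊔ b) ⊢ a ⊔ b]
| ax_neg_cap a : PDBL [¬ (a ⊓ a) ⊢ ¬ a]
| ax_lneg_cup a : PDBL [⌟ a ⊢ ⌟ (a ⊔ a)]
| ax_cap_neg a : PDBL [a ⊓ ¬ a ⊢ ⊥]
| ax_cup_lneg a : PDBL [⊤ ⊢ a ⊔ ⌟ a]
| ax_negneg_1 a b : PDBL [¬ ¬ (a ⊓ b) ⊢ a ⊓ b]
| ax_negneg_2 a b : PDBL [a ⊓ b ⊢ ¬ ¬ (a ⊓ b)]
| ax_lneglneg_1 a b : PDBL [⌟ ⌟ (a ⊔ b) ⊢ a ⊔ b]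
| ax_lneglneg_2 a b : PDBL [a ⊔ b ⊢ ⌟ ⌟ (a ⊔ b)]
| ax_cap_cup_absorb a b : PDBL [a ⊓ a ⊢ a ⊓ (a ⊔ b)]
| ax_cup_cap_absorb a b : PDBL [a ⊔ (a ⊓ b) ⊢ a ⊔ a]
| ax_cap_vee_absorb a b : PDBL [a ⊓ a ⊢ a ⊓ (a ∨ b)]
| ax_cup_wedge_absorb a b : PDBL [a ⊔ (a ∧ b) ⊢ a ⊔ a]
| ax_cap_vee_distr_1 a b c : PDBL [a ⊓ (b ∨ c) ⊢ (a ⊓ b) ∨ (a ⊓ c)]
| ax_cap_vee_distr_2 a b c : PDBL [(a ⊓ b) ∨ (a ⊓ c) ⊢ a ⊓ (b ∨ c)]
| ax_cup_wedge_distr_1 a b c : PDBL [a ⊔ (b ∧ c) ⊢ (a ⊔ b) ∧ (a ⊔ c)]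
| ax_cup_wedge_distr_2 a b c : PDBL [(a ⊔ b) ∧ (a ⊔ c) ⊢ a ⊔ (b ∧ c)]
| ax_bot a : PDBL [⊥ ⊢ a]
| ax_top a : PDBL [a ⊢ ⊤]
| ax_neg_top : PDBL [¬ ⊤ ⊢ ⊥]
| ax_lneg_bot : PDBL [⊤ ⊢ ⌟ ⊥]
| ax_neg_bot_1 : PDBL [¬ ⊥ ⊢ ⊤ ⊓ ⊤]
| ax_neg_bot_2 : PDBL [⊤ ⊓ ⊤ ⊢ ¬ ⊥]
| ax_lneg_top_1 : PDBL [⌟ ⊤ ⊢ ⊥ ⊔ ⊥]
| ax_lneg_top_2 : PDBL [⊥ ⊔ ⊥ ⊢ ⌟ ⊤]
| ax_cup_cap_1 a : PDBL [(a ⊔ a) ⊓ (a ⊔ a) ⊢ (a ⊓ a) ⊔ (a ⊓ a)]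
| ax_cup_cap_2 a : PDBL [(a ⊓ a) ⊔ (a ⊓ a) ⊢ (a ⊔ a) ⊓ (a ⊔ a)]
| ax_OV_1 p : PDBL [OV p ⊓ OV p ⊢ OV p]
| ax_OV_2 p : PDBL [OV p ⊢ OV p ⊓ OV p]
| ax_PV_1 P : PDBL [PV P ⊔ PV P ⊢ PV P]
| ax_PV_2 P : PDBL [PV P ⊢ PV P ⊔ PV P]
| ax_Sp a : PDBL [a ⊢ a ⊓ a; a ⊔ a ⊢ a].

Inductive MPDBL : hypersequent -> Prop :=
| ax_PDBL G : PDBL G -> MPDBL G
| ax_box_cap_1 a b : MPDBL [□ a ⊓ □ b ⊢ □ (a ⊓ b)]
| ax_box_cap_2 a b : MPDBL [□ (a ⊓ b) ⊢ □ a ⊓ □ b]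
| ax_bbox_cup_1 a b : MPDBL [■ a ⊔ ■ b ⊢ ■ (a ⊔ b)]
| ax_bbox_cup_2 a b : MPDBL [■ (a ⊔ b) ⊢ ■ a ⊔ ■ b]
| ax_box_neg_bot_1 : MPDBL [□ (¬ ⊥) ⊢ ¬ ⊥]
| ax_box_neg_bot_2 : MPDBL [¬ ⊥ ⊢ □ (¬ ⊥)]
| ax_bbox_lneg_top_1 : MPDBL [■ (⌟ ⊤) ⊢ ⌟ ⊤]
| ax_bbox_lneg_top_2 : MPDBL [⌟ ⊤ ⊢ ■ (⌟ ⊤)]
| ax_box_dup_1 a : MPDBL [□ (a ⊓ a) ⊢ □ a]
| ax_box_dup_2 a : MPDBL [□ a ⊢ □ (a ⊓ a)]
| ax_bbox_dup_1 a : MPDBL [■ (a ⊔ a) ⊢ ■ a]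
| ax_bbox_dup_2 a : MPDBL [■ a ⊢ ■ (a ⊔ a)].

Inductive MPDBL4 : hypersequent -> Prop :=
| ax_MPDBL G : MPDBL G -> MPDBL4 G
| ax_box_T a : MPDBL4 [□ a ⊢ a]
| ax_bbox_T a : MPDBL4 [a ⊢ ■ a]
| ax_box_4_1 a : MPDBL4 [□ □ a ⊢ □ a]
| ax_box_4_2 a : MPDBL4 [□ a ⊢ □ □ a]
| ax_bbox_4_1 a : MPDBL4 [■ ■ a ⊢ ■ a]
| ax_bbox_4_2 a : MPDBL4 [■ a ⊢ ■ ■ a].

(* [L] is the set of axioms. The rules, including those for [□] and [■], are
   common to both modal logics, which differ only in their axioms. *)
Inductive provable (L : hypersequent -> Prop) : hypersequent -> Prop :=
| r_axiom G : L G -> provable L G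
| r_cap_r B C a b c :
    provable L (B ++ [a ⊢ b] ++ C) -> provable L (B ++ [a ⊓ c ⊢ b ⊓ c] ++ C)
| r_cap_l B C a b c :
    provable L (B ++ [a ⊢ b] ++ C) -> provable L (B ++ [c ⊓ a ⊢ c ⊓ b] ++ C)
| r_cup_r B C a b c :
    provable L (B ++ [a ⊢ b] ++ C) -> provable L (B ++ [a ⊔ c ⊢ b ⊔ c] ++ C)
| r_cup_l B C a b c :
    provable L (B ++ [a ⊢ b] ++ C) -> provable L (B ++ [c ⊔ a ⊢ c ⊔ b] ++ C)
| r_neg B C a b :
    provable L (B ++ [a ⊢ b] ++ C) -> provable L (B ++ [¬ b ⊢ ¬ a] ++ C)
| r_lneg B C a b :
    provable L (B ++ [a ⊢ b] ++ C) -> provable L (B ++ [⌟ b ⊢ ⌟ a] ++ C)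
| r_box B C a b :
    provable L (B ++ [a ⊢ b] ++ C) -> provable L (B ++ [□ a ⊢ □ b] ++ C)
| r_bbox B C a b :
    provable L (B ++ [a ⊢ b] ++ C) -> provable L (B ++ [■ a ⊢ ■ b] ++ C)
| r_trans B C D E a b c :
    provable L (B ++ [a ⊢ b] ++ C) ->
    provable L (D ++ [b ⊢ c] ++ E) ->
    provable L (B ++ D ++ [a ⊢ c] ++ C ++ E)
| r_order B C D E F G H X a b :
    provable L (B ++ [a ⊓ b ⊢ a ⊓ a] ++ C) ->
    provable L (D ++ [a ⊓ a ⊢ a ⊓ b] ++ E) ->
    provable L (F ++ [a ⊔ b ⊢ b ⊔ b] ++ G) ->
    provable L (H ++ [b ⊔ b ⊢ a ⊔ b] ++ X) ->
    provable L (B ++ D ++ F ++ H ++ [a ⊢ b] ++ C ++ E ++ G ++ X)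
| r_contraction B C D :
    provable L (B ++ D ++ D ++ C) -> provable L (B ++ D ++ C)
| r_exchange B C D E :
    provable L (B ++ D ++ E ++ C) -> provable L (B ++ E ++ D ++ C)
| r_weakening B C :
    provable L B -> provable L (B ++ C).

Record valuation (D : pdBao) : Type := {
  val_OV : nat -> D;
  val_PV : nat -> D;
  val_OV_cap : forall p, in_cap (val_OV p);
  val_PV_cup : forall P, in_cup (val_PV P)
}.

Arguments val_OV {_}.
Arguments val_PV {_}.

Fixpoint eval {D : pdBao} (v : valuation D) (a : form) : D :=
  match a with
  | OV p => val_OV v p
  | PV P => val_PV v P
  | FTop => top
  | FBot => bot
  | FCap a b => cap (eval v a) (eval v b)
  | FCup a b => cup (eval v a) (eval v b)
  | FNeg a => neg (eval v a)
  | FLneg a => lneg (eval v a)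
  | FBox a => opI (eval v a)
  | FBlackbox a => opC (eval v a)
  end.

Definition sat_sequent {D : pdBao} (v : valuation D) (s : sequent) : Prop :=
  sqle (eval v (ant s)) (eval v (suc s)).

Definition satisfies {D : pdBao} (v : valuation D) (G : hypersequent) : Prop :=
  Exists (sat_sequent v) G.

Definition true_in (D : pdBao) (G : hypersequent) : Prop :=
  forall v : valuation D, satisfies v G.

Definition valid_in (K : pdBao -> Prop) (G : hypersequent) : Prop :=
  forall D : pdBao, K D -> true_in D G.

(* Main.v *)
(** Completeness: the components of an unprovable s-hypersequent extend to a maximal
    set [R] of sequents none of whose finite sublists is provable. By the external rules,
    the sequents outside [R] are closed under all rules and contain, of each axiom, at
    least one component; applied to (Sp), this makes their Lindenbaum algebra pure.
    The canonical valuation into that algebra refutes exactly the sequents of [R]. *)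

From Stdlib Require Import List Cantor Classical ClassicalEpsilon.
From Stdlib Require Import FunctionalExtensionality PropExtensionality ProofIrrelevance.
Require Import Defs.
Import ListNotations.

(** * Order theory of double Boolean algebras *)

(** Exchanging the two halves of the signature maps the axioms to one another and reverses [⊑].
    Facts about [⊔] and [⌟] are then instances of facts about [⊓] and [¬]. *)
Definition dual_sig (D : dBa_sig) : dBa_sig := {|
  carrier := D;
  cup := @cap D; cap := @cup D;
  neg := @lneg D; lneg := @neg D;
  top := @bot D; bot := @top D |}.

Lemma dual_is_dBa (D : dBa) : is_dBa (dual_sig D).
Proof.
  destruct (dBa_axioms D); constructor; cbn; auto.
Qed.

Definition dual (D : dBa) : dBa := {|
  dBa_base := dual_sig D; dBa_axioms := dual_is_dBa D |}.

Lemma sqle_dual (D : dBa) (x y : D) : @sqle (dual D) x y <-> @sqle D y x.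
Proof.
  unfold sqle; cbn.
  rewrite (cup_comm _ (dBa_axioms D) x y), (cap_comm _ (dBa_axioms D) x y); tauto.
Qed.

Section Algebra.
Context {D : dBa}.
Implicit Types x y z : D.
Local Open Scope dba_scope.
Local Notation ax := (dBa_axioms D).

Lemma cap_idem_r x y : x ⊓ (y ⊓ y) = x ⊓ y.
Proof.
  now rewrite (cap_comm _ ax), (cap_idem_l _ ax), (cap_comm _ ax).
Qed.

Lemma cap_in_cap x y : in_cap (x ⊓ y).
Proof.
  unfold in_cap.
  now rewrite <- (cap_assoc _ ax), (cap_comm _ ax y (x ⊓ y)), <- (cap_assoc _ ax),
    cap_idem_r, (cap_assoc _ ax), (cap_idem_l _ ax).
Qed.

Lemma sqle_refl x : x ⊑ x.
Proof. now split. Qed.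

Lemma sqle_eq x y : x = y -> x ⊑ y.
Proof. intros <-; apply sqle_refl. Qed.

(** In a general double Boolean algebra, mutual [⊑] only identifies [x ⊓ x] with [y ⊓ y] and [x ⊔ x]
    with [y ⊔ y]; hence the restriction to one half. *)
Lemma sqle_antisym_cap x y : in_cap x -> in_cap y -> x ⊑ y -> y ⊑ x -> x = y.
Proof.
  unfold in_cap; intros Hx Hy [Hxy _] [Hyx _].
  now rewrite <- Hx, <- Hxy, (cap_comm _ ax), Hyx.
Qed.

(** The meet half of transitivity, kept separate so that its dual instance supplies the join
    half. *)
Lemma cap_trans x y z : x ⊓ y = x ⊓ x -> y ⊓ z = y ⊓ y -> x ⊓ z = x ⊓ x.
Proof.
  intros Hxy Hyz.
  now rewrite <- (cap_idem_l _ ax), <- Hxy, <- (cap_assoc _ ax), Hyz, cap_idem_r.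
Qed.

Lemma cap_sqle_l x y : x ⊓ y ⊑ x.
Proof.
  split.
  - rewrite cap_in_cap.
    now rewrite (cap_comm _ ax (x ⊓ y)), (cap_assoc _ ax), (cap_idem_l _ ax).
  - now rewrite (cup_comm _ ax), (cup_cap_absorb _ ax).
Qed.

Lemma cap_sqle_r x y : x ⊓ y ⊑ y.
Proof. rewrite (cap_comm _ ax); apply cap_sqle_l. Qed.

(** A single meet equation suffices here: the join half of [⊑] comes from absorption, through
    [cap_sqle_r]. *)
Lemma sqle_of_cap_eq x y : x = x ⊓ y -> x ⊑ y.
Proof. intros ->; apply cap_sqle_r. Qed.

Lemma cap_mono_l x y z : x ⊑ y -> x ⊓ z ⊑ y ⊓ z.
Proof.
  intros [H _]; apply sqle_of_cap_eq.
  rewrite (cap_comm _ ax y z), (cap_assoc _ ax), <- (cap_assoc _ ax x z z), cap_idem_r.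
  now rewrite <- (cap_assoc _ ax), (cap_comm _ ax z y), (cap_assoc _ ax), H,
    (cap_idem_l _ ax).
Qed.

Lemma cap_mono_r x y z : x ⊑ y -> z ⊓ x ⊑ z ⊓ y.
Proof.
  rewrite (cap_comm _ ax z x), (cap_comm _ ax z y); apply cap_mono_l.
Qed.

Lemma negneg x : ¬ ¬ x = x ⊓ x.
Proof. now rewrite <- (neg_cap_idem _ ax x), (negneg_cap _ ax). Qed.

Lemma neg_in_cap x : in_cap (¬ x).
Proof.
  unfold in_cap.
  now rewrite <- negneg, (negneg x), (neg_cap_idem _ ax).
Qed.

Lemma neg_anti x y : x ⊑ y -> ¬ y ⊑ ¬ x.
Proof.
  intros [H _]; apply sqle_of_cap_eq.
  (* By double negation the right side is [¬ (y ⊓ x)], and [y ⊓ x] equals [x ⊓ x]. Absorption of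
     [¬ y] in this join then gives the claim. *)
  assert (E : ¬ x = ¬ y ∨ ¬ x).
  { unfold vee.
    now rewrite !negneg, (cap_idem_l _ ax), cap_idem_r, (cap_comm _ ax), H,
      (neg_cap_idem _ ax). }
  rewrite E, (cap_vee_absorb _ ax); symmetry; apply neg_in_cap.
Qed.

Lemma bot_sqle x : ⊥ ⊑ x.
Proof. rewrite <- (cap_neg _ ax x); apply cap_sqle_l. Qed.

End Algebra.

Section AlgebraDual.
Context {D : dBa}.
Implicit Types x y z : D.
Local Open Scope dba_scope.

Lemma cup_in_cup x y : in_cup (x ⊔ y).
Proof. exact (@cap_in_cap (dual D) x y). Qed.

Lemma sqle_trans x y z : x ⊑ y -> y ⊑ z -> x ⊑ z.
Proof.
  intros [Hxy Hxy'] [Hyz Hyz']; split.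
  - exact (cap_trans x y z Hxy Hyz).
  - rewrite (cup_comm _ (dBa_axioms D)) in Hxy', Hyz' |- *.
    exact (@cap_trans (dual D) z y x Hyz' Hxy').
Qed.

Lemma sqle_antisym_cup x y : in_cup x -> in_cup y -> x ⊑ y -> y ⊑ x -> x = y.
Proof.
  intros Hx Hy Hxy Hyx.
  now apply (@sqle_antisym_cap (dual D)); try apply sqle_dual.
Qed.

Lemma sqle_cup_l x y : x ⊑ x ⊔ y.
Proof. apply sqle_dual, (@cap_sqle_l (dual D)). Qed.

Lemma sqle_cup_r x y : y ⊑ x ⊔ y.
Proof. apply sqle_dual, (@cap_sqle_r (dual D)). Qed.

Lemma cup_mono_l x y z : x ⊑ y -> x ⊔ z ⊑ y ⊔ z.
Proof.
  intros H; apply sqle_dual, (@cap_mono_l (dual D)); now apply sqle_dual.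
Qed.

Lemma cup_mono_r x y z : x ⊑ y -> z ⊔ x ⊑ z ⊔ y.
Proof.
  intros H; apply sqle_dual, (@cap_mono_r (dual D)); now apply sqle_dual.
Qed.

Lemma lneg_anti x y : x ⊑ y -> ⌟ y ⊑ ⌟ x.
Proof.
  intros H; apply sqle_dual, (@neg_anti (dual D)); now apply sqle_dual.
Qed.

Lemma sqle_top x : x ⊑ ⊤.
Proof. apply sqle_dual, (@bot_sqle (dual D)). Qed.

(** The algebraic content of [r_order]: both sides of each pair lie in the same half, where
    antisymmetry turns the inequalities into the equations defining [⊑]. *)
Lemma sqle_of_halves x y :
  x ⊓ y ⊑ x ⊓ x -> x ⊓ x ⊑ x ⊓ y -> x ⊔ y ⊑ y ⊔ y -> y ⊔ y ⊑ x ⊔ y -> x ⊑ y.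
Proof.
  intros; split.
  - apply sqle_antisym_cap; auto using cap_in_cap.
  - apply sqle_antisym_cup; auto using cup_in_cup.
Qed.

End AlgebraDual.

(** * Soundness *)

Section Soundness.
Context {D : pdBao} (v : valuation D).

Local Notation sat := (sat_sequent v).

Lemma PDBL_sound G : PDBL G -> satisfies v G.
Proof.
  pose proof (dBa_axioms D) as ax.
  intros []; unfold satisfies;
    (* (Sp) is the only axiom with two components; purity decides which of them holds. *)
    [.. | destruct (pdBa_pure _ (eval v a)) as [H|H];
          [apply Exists_cons_hd | apply Exists_cons_tl, Exists_cons_hd];
          apply sqle_eq; cbn; now rewrite H ];
    apply Exists_cons_hd; unfold sat_sequent; cbn;
    try (apply sqle_eq; first [apply ax | symmetry; apply ax]; fail);
    auto using sqle_refl, cap_sqle_l, cap_sqle_r, sqle_cup_l, sqle_cup_r,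
      bot_sqle, sqle_top;
    (* What remains is idempotence: the duplication axioms and those for object and property
       variables. *)
    apply sqle_eq;
    first [apply cup_in_cup | apply val_OV_cap | apply val_PV_cup
          | symmetry; first [apply cap_in_cap | apply val_OV_cap | apply val_PV_cup]].
Qed.

Lemma MPDBL_sound G : MPDBL G -> satisfies v G.
Proof.
  intros []; [now apply PDBL_sound | ..];
    apply Exists_cons_hd; unfold sat_sequent; cbn; apply sqle_eq;
    first [ apply opI_cap | apply opC_cup | apply opI_neg_bot | apply opC_lneg_top
          | apply opI_cap_idem | apply opC_cup_idem
          | symmetry; apply opI_cap | symmetry; apply opC_cup
          | symmetry; apply opI_neg_bot | symmetry; apply opC_lneg_top
          | symmetry; apply opI_cap_idem | symmetry; apply opC_cup_idem ].
Qed.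

Lemma MPDBL4_sound G : topological D -> MPDBL4 G -> satisfies v G.
Proof.
  intros HD []; [now apply MPDBL_sound | ..];
    apply Exists_cons_hd; unfold sat_sequent; cbn;
    try apply HD; apply sqle_eq; try apply HD; symmetry; apply HD.
Qed.

Lemma satisfies_step B C s s' :
  (sat s -> sat s') -> satisfies v (B ++ [s] ++ C) -> satisfies v (B ++ [s'] ++ C).
Proof.
  unfold satisfies; intros H; rewrite !Exists_app, !Exists_cons, !Exists_nil; tauto.
Qed.

Lemma provable_sound L :
  (forall G, L G -> satisfies v G) -> forall G, provable L G -> satisfies v G.
Proof.
  intros HL G HG; induction HG; auto;
    try (revert IHHG; apply satisfies_step; unfold sat_sequent; cbn;
         auto using cap_mono_l, cap_mono_r, cup_mono_l, cup_mono_r, neg_anti, lneg_anti,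
           opI_mono, opC_mono; fail);
    (* Read as disjunctions over components, the external rules are propositional; only [r_trans]
       and [r_order] then call for an algebraic fact. *)
    unfold satisfies in *;
    rewrite ?Exists_app, ?Exists_cons, ?Exists_nil in *; unfold sat_sequent in *;
    cbn in *; try tauto.
  - pose proof (sqle_trans (eval v a) (eval v b) (eval v c)); tauto.
  - pose proof (sqle_of_halves (eval v a) (eval v b)); tauto.
Qed.

End Soundness.

(** * Maximal refuted sets of sequents *)

(** A Gödel numbering by Cantor pairing, with a tag for the head constructor. Its injectivity
    ensures that each stage below adds at most one sequent. *)
Fixpoint form_code (a : form) : nat :=
  match a with
  | OV p => to_nat (0, p)
  | PV P => to_nat (1, P)
  | FTop => to_nat (2, 0)
  | FBot => to_nat (3, 0)
  | FCap a b => to_nat (4, to_nat (form_code a, form_code b))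
  | FCup a b => to_nat (5, to_nat (form_code a, form_code b))
  | FNeg a => to_nat (6, form_code a)
  | FLneg a => to_nat (7, form_code a)
  | FBox a => to_nat (8, form_code a)
  | FBlackbox a => to_nat (9, form_code a)
  end.

Local Opaque to_nat.

Lemma form_code_inj a b : form_code a = form_code b -> a = b.
Proof.
  revert b; induction a; intros []; cbn [form_code]; intros H; apply to_nat_inj in H;
    try discriminate H; try reflexivity; injection H as H; try apply to_nat_inj in H;
    try injection H as H H'; f_equal; auto.
Qed.

Definition sequent_code (s : sequent) : nat :=
  to_nat (form_code (ant s), form_code (suc s)).

Lemma sequent_code_inj s t : sequent_code s = sequent_code t -> s = t.
Proof.
  destruct s, t; unfold sequent_code; intros H; apply to_nat_inj in H.
  injection H as H1 H2; f_equal; now apply form_code_inj.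
Qed.

Definition refuted_set L (R : sequent -> Prop) : Prop :=
  forall G, Forall R G -> ~ provable L G.

(** Maximality in the form in which it is used: a sequent outside [R] comes with finitely many side
    components from [R] that make it provable. *)
Definition maximal_refuted L (R : sequent -> Prop) : Prop :=
  refuted_set L R /\ forall s, ~ R s -> exists G, Forall R G /\ provable L (s :: G).

Lemma provable_absorb L s G : In s G -> provable L (s :: G) -> provable L G.
Proof.
  intros Hs HP; apply in_split in Hs as (G1 & G2 & ->).
  apply (r_contraction L G1 G2 [s]).
  exact (r_exchange L [] ([s] ++ G2) [s] G1 HP).
Qed.

(** The external rules make provability depend only on the set of components: weaken by all of [G'],
    then absorb the members of [G] one by one by exchange and contraction. *)
Lemma provable_incl L G G' : incl G G' -> provable L G -> provable L G'.
Proof.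
  intros Hincl HP; apply (r_weakening L G G') in HP; revert Hincl HP.
  induction G as [|s G IH]; intros Hincl HP; [exact HP|].
  apply incl_cons_inv in Hincl as [Hs Hincl].
  apply IH; [exact Hincl|].
  apply provable_absorb with s; [apply in_or_app; now right | exact HP].
Qed.

Section Lindenbaum.
Context (L : hypersequent -> Prop) (R0 : sequent -> Prop).

(** Stage [S n] decides the sequent of code [n], if there is one: it enters when the enlarged set
    stays refuted. *)
Fixpoint stage (n : nat) : sequent -> Prop :=
  match n with
  | 0 => R0
  | S n => fun s => stage n s \/
      (sequent_code s = n /\ refuted_set L (fun t => stage n t \/ t = s))
  end.

Lemma stage_mono n m s : n <= m -> stage n s -> stage m s.
Proof. induction 1; cbn; auto. Qed.

Lemma stage_refuted n : refuted_set L R0 -> refuted_set L (stage n).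
Proof.
  intros H0; induction n as [|n IH]; [exact H0 | intros G HG].
  (* If some [s] of code [n] passes the test, the new stage lies within the old one plus [s], by
     injectivity of the code; otherwise nothing is added. *)
  destruct (classic (exists s, sequent_code s = n /\
    refuted_set L (fun t => stage n t \/ t = s))) as [(s & Hs & Href)|Hno].
  - apply Href; revert HG; apply Forall_impl; intros t [Ht|[Ht _]]; [now left | right].
    apply sequent_code_inj; congruence.
  - apply IH; revert HG; apply Forall_impl; intros t [Ht|Ht]; [assumption|].
    destruct Hno; now exists t.
Qed.

Definition limit (s : sequent) : Prop := exists n, stage n s.

Lemma Forall_limit G : Forall limit G -> exists n, Forall (stage n) G.
Proof.
  induction 1 as [|s G [n Hn] _ [m Hm]]; [now exists 0|].
  exists (n + m); constructor.
  - apply stage_mono with n; auto with arith.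
  - revert Hm; apply Forall_impl; intros t; apply stage_mono; auto with arith.
Qed.

(** Gathers all occurrences of [s] into a single one at the head, the shape that maximality asks
    for. *)
Lemma Forall_separate (R : sequent -> Prop) s G :
  Forall (fun t => R t \/ t = s) G -> exists G', Forall R G' /\ incl G (s :: G').
Proof.
  induction 1 as [|t G Ht _ (G' & HG' & Hincl)].
  - exists []; split; [constructor | apply incl_nil_l].
  - destruct Ht as [Ht| ->].
    + exists (t :: G'); split; [now constructor|].
      intros u [<-|Hu]; [now right; left|].
      destruct (Hincl u Hu); [now left | now right; right].
    + exists G'; split; [assumption|].
      apply incl_cons; [now left | exact Hincl].
Qed.

Lemma limit_maximal : refuted_set L R0 -> maximal_refuted L limit.
Proof.
  intros H0; split.
  - intros G HG; destruct (Forall_limit G HG) as [n Hn].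
    now apply (stage_refuted n H0).
  - intros s Hs.
    (* Since [s] never enters, it failed the test made for its own code; the failure yields a
       provable list over that stage plus [s]. *)
    destruct (not_all_ex_not _ _ (fun H : refuted_set L
      (fun t => stage (sequent_code s) t \/ t = s) =>
      Hs (ex_intro _ (S (sequent_code s)) (or_intror (conj eq_refl H))))) as [G HG].
    apply imply_to_and in HG as [HG HP]; apply NNPP in HP.
    destruct (Forall_separate limit s G) as (G' & HG' & Hincl).
    + revert HG; apply Forall_impl; intros t [Ht|Ht]; [left; now exists (sequent_code s) | auto].
    + exists G'; split; [exact HG' | now apply provable_incl with G].
Qed.

End Lindenbaum.

Lemma exists_maximal_refuted L G : ~ provable L G ->
  exists R, maximal_refuted L R /\ Forall R G.
Proof.
  intros HG; exists (limit L (fun s => In s G)); split.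
  - apply limit_maximal; intros H HH HP; apply HG.
    apply provable_incl with H; [exact (proj1 (Forall_forall _ _) HH) | exact HP].
  - apply Forall_forall; intros s Hs; now exists 0.
Qed.

(** * The Lindenbaum algebra *)

(* Applied to [⊓] with the derivability order, and to [⊔] with its converse. *)
Record premeet {A} (le : A -> A -> Prop) (m : A -> A -> A) : Prop := {
  pm_refl : forall a, le a a;
  pm_trans : forall a b c, le a b -> le b c -> le a c;
  pm_l : forall a b, le (m a b) a;
  pm_r : forall a b, le (m a b) b;
  pm_mono_l : forall a b c, le a b -> le (m a c) (m b c);
  pm_mono_r : forall a b c, le a b -> le (m c a) (m c b);
  pm_dup : forall a b, le (m a b) (m (m a b) (m a b))
}.

Definition equiv {A} (le : A -> A -> Prop) (a b : A) : Prop := le a b /\ le b a.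

Section Premeet.
Context {A} {le : A -> A -> Prop} {m : A -> A -> A} (pm : premeet le m).

(** The laws do not give [le a (m a a)] for every [a], so the greatest lower bound property is
    confined to lower bounds that are themselves meets, which [pm_dup] can duplicate. *)
Lemma premeet_glb a b c d : le (m a b) c -> le (m a b) d -> le (m a b) (m c d).
Proof.
  destruct pm as [_ trans _ _ mono_l mono_r dup]; intros Hc Hd.
  eapply trans; [apply dup|].
  eapply trans; [apply mono_l, Hc | apply mono_r, Hd].
Qed.

Lemma premeet_le_l a b c : le a c -> le (m a b) c.
Proof. intros H; exact (pm_trans _ _ pm _ _ _ (pm_l _ _ pm a b) H). Qed.

Lemma premeet_le_r a b c : le b c -> le (m a b) c.
Proof. intros H; exact (pm_trans _ _ pm _ _ _ (pm_r _ _ pm a b) H). Qed.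

Lemma premeet_refl a : le a a.
Proof. apply (pm_refl _ _ pm). Qed.

Local Hint Resolve premeet_glb premeet_le_l premeet_le_r premeet_refl : core.

Lemma premeet_comm a b : equiv le (m a b) (m b a).
Proof. split; auto. Qed.

Lemma premeet_assoc a b c : equiv le (m a (m b c)) (m (m a b) c).
Proof. split; auto 6. Qed.

Lemma premeet_idem_l a b : equiv le (m (m a a) b) (m a b).
Proof. split; auto. Qed.

Lemma premeet_absorb a c : le (m a a) (m a c) -> equiv le (m a c) (m a a).
Proof. split; auto. Qed.

Lemma premeet_le a b : le a b -> equiv le (m a b) (m a a).
Proof.
  split; auto.
Qed.

End Premeet.

Section Model.
Context (L : hypersequent -> Prop) (HL : forall G, MPDBL G -> L G).
Context (R : sequent -> Prop) (HR : maximal_refuted L R).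

(** By maximality, this is provability relative to side components taken from [R]. *)
Definition derives (a b : form) : Prop := ~ R (Sequent a b).
Local Notation eqv := (equiv derives).
Local Open Scope form_scope.

Lemma not_refuted_axiom s : L [s] -> ~ R s.
Proof.
  intros H Hs; apply (proj1 HR [s]); [now repeat constructor | now apply r_axiom].
Qed.

(** The side components that witness the premise also serve the conclusion, so every one-premise
    rule passes to [derives]. The leading [[]] matches the left context in the shape of the
    rules. *)
Lemma not_refuted_rule s s' :
  (forall C, provable L ([] ++ [s] ++ C) -> provable L ([] ++ [s'] ++ C)) ->
  ~ R s -> ~ R s'.
Proof.
  intros Hrule Hs Hs'; destruct (proj2 HR s Hs) as (G & HG & HP).
  apply (proj1 HR (s' :: G)); [now constructor | now apply Hrule].
Qed.

Lemma derives_axiom a b : PDBL [a ⊢ b] -> derives a b.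
Proof. intros H; apply not_refuted_axiom, HL, ax_PDBL, H. Qed.

Lemma derives_modal a b : MPDBL [a ⊢ b] -> derives a b.
Proof. intros H; apply not_refuted_axiom, HL, H. Qed.

Lemma derives_trans a b c : derives a b -> derives b c -> derives a c.
Proof.
  intros Hab Hbc Hac.
  destruct (proj2 HR _ Hab) as (G & HG & HP), (proj2 HR _ Hbc) as (H & HH & HQ).
  apply (proj1 HR ([a ⊢ c] ++ G ++ H)).
  - constructor; [exact Hac | apply Forall_app; auto].
  - exact (r_trans L [] G [] H a b c HP HQ).
Qed.

(** The hypotheses are the two equations defining [⊑], read in the quotient; [r_order] recovers
    derivability from them. *)
Lemma derives_order a b :
  eqv (a ⊓ b) (a ⊓ a) -> eqv (a ⊔ b) (b ⊔ b) -> derives a b.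
Proof.
  intros [H1 H2] [H3 H4] Hab.
  destruct (proj2 HR _ H1) as (G1 & F1 & P1), (proj2 HR _ H2) as (G2 & F2 & P2),
    (proj2 HR _ H3) as (G3 & F3 & P3), (proj2 HR _ H4) as (G4 & F4 & P4).
  apply (proj1 HR ([a ⊢ b] ++ G1 ++ G2 ++ G3 ++ G4)).
  - constructor; [exact Hab | rewrite !Forall_app; auto].
  - exact (r_order L [] G1 [] G2 [] G3 [] G4 a b P1 P2 P3 P4).
Qed.

Lemma premeet_cap : premeet derives FCap.
Proof.
  constructor; try (intros; apply derives_axiom; constructor).
  - exact derives_trans.
  - intros a b c; apply not_refuted_rule; intros C; apply r_cap_r.
  - intros a b c; apply not_refuted_rule; intros C; apply r_cap_l.
Qed.

Lemma premeet_cup : premeet (fun a b => derives b a) FCup.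
Proof.
  constructor; try (intros; apply derives_axiom; constructor).
  - intros a b c H1 H2; exact (derives_trans c b a H2 H1).
  - intros a b c; apply not_refuted_rule; intros C; apply r_cup_r.
  - intros a b c; apply not_refuted_rule; intros C; apply r_cup_l.
Qed.

Lemma derives_neg a b : derives a b -> derives (¬ b) (¬ a).
Proof. apply not_refuted_rule; intros C; apply r_neg. Qed.

Lemma derives_lneg a b : derives a b -> derives (⌟ b) (⌟ a).
Proof. apply not_refuted_rule; intros C; apply r_lneg. Qed.

Lemma derives_box a b : derives a b -> derives (□ a) (□ b).
Proof. apply not_refuted_rule; intros C; apply r_box. Qed.

Lemma derives_bbox a b : derives a b -> derives (■ a) (■ b).
Proof. apply not_refuted_rule; intros C; apply r_bbox. Qed.

Lemma equiv_flip a b : equiv (fun a b => derives b a) a b -> eqv a b.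
Proof. unfold equiv; tauto. Qed.

Lemma equiv_refl a : eqv a a.
Proof. split; apply (pm_refl _ _ premeet_cap). Qed.

Lemma equiv_sym a b : eqv a b -> eqv b a.
Proof. unfold equiv; tauto. Qed.

Lemma equiv_trans a b c : eqv a b -> eqv b c -> eqv a c.
Proof. intros [] []; split; eauto using derives_trans. Qed.

Lemma equiv_cap a b c d : eqv a b -> eqv c d -> eqv (a ⊓ c) (b ⊓ d).
Proof.
  intros [] []; split;
    (eapply derives_trans;
      [eapply (pm_mono_l _ _ premeet_cap) | eapply (pm_mono_r _ _ premeet_cap)]; eassumption).
Qed.

Lemma equiv_cup a b c d : eqv a b -> eqv c d -> eqv (a ⊔ c) (b ⊔ d).
Proof.
  intros [] []; split;
    (eapply derives_trans;
      [eapply (pm_mono_l _ _ premeet_cup) | eapply (pm_mono_r _ _ premeet_cup)]; eassumption).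
Qed.

Lemma equiv_neg a b : eqv a b -> eqv (¬ a) (¬ b).
Proof. intros []; split; now apply derives_neg. Qed.

Lemma equiv_lneg a b : eqv a b -> eqv (⌟ a) (⌟ b).
Proof. intros []; split; now apply derives_lneg. Qed.

Lemma equiv_box a b : eqv a b -> eqv (□ a) (□ b).
Proof. intros []; split; now apply derives_box. Qed.

Lemma equiv_bbox a b : eqv a b -> eqv (■ a) (■ b).
Proof. intros []; split; now apply derives_bbox. Qed.

(** Equivalent formulae have extensionally equal predicates [eqv a], so [epsilon] picks the same
    representative for them. The quotient is then the type of formulae fixed by [canon]. *)
Definition canon (a : form) : form := epsilon (inhabits FTop) (eqv a).

Lemma canon_equiv a : eqv a (canon a).
Proof. apply (epsilon_spec (inhabits FTop) (eqv a)); exists a; apply equiv_refl. Qed.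

Lemma canon_eq a b : eqv a b -> canon a = canon b.
Proof.
  intros H; unfold canon; f_equal; extensionality c; apply propositional_extensionality.
  split; intros Hc; eapply equiv_trans; eauto; now apply equiv_sym.
Qed.

Definition quot : Type := {a : form | canon a = a}.

Definition cls (a : form) : quot :=
  exist _ (canon a) (canon_eq (canon a) a (equiv_sym _ _ (canon_equiv a))).

Lemma cls_eq a b : eqv a b -> cls a = cls b.
Proof. intros H; apply subset_eq_compat, canon_eq, H. Qed.

Lemma equiv_of_cls a b : cls a = cls b -> eqv a b.
Proof.
  intros H; apply (f_equal (@proj1_sig _ _)) in H; cbn in H.
  eapply equiv_trans; [apply canon_equiv|]; rewrite H; apply equiv_sym, canon_equiv.
Qed.

Lemma cls_repr (q : quot) : cls (proj1_sig q) = q.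
Proof. destruct q as [a Ha]; now apply subset_eq_compat. Qed.

Definition lind_sig : dBa_sig := {|
  carrier := quot;
  cup q r := cls (proj1_sig q ⊔ proj1_sig r);
  cap q r := cls (proj1_sig q ⊓ proj1_sig r);
  neg q := cls (¬ proj1_sig q);
  lneg q := cls (⌟ proj1_sig q);
  top := cls ⊤;
  bot := cls ⊥ |}.

Local Notation clsD a := (cls a : lind_sig).

Lemma repr_cls a : eqv (proj1_sig (cls a)) a.
Proof. apply equiv_sym, canon_equiv. Qed.

Lemma cap_cls a b : cap (clsD a) (clsD b) = clsD (a ⊓ b).
Proof. apply cls_eq, equiv_cap; apply repr_cls. Qed.

Lemma cup_cls a b : cup (clsD a) (clsD b) = clsD (a ⊔ b).
Proof. apply cls_eq, equiv_cup; apply repr_cls. Qed.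

Lemma neg_cls a : neg (clsD a) = clsD (¬ a).
Proof. apply cls_eq, equiv_neg, repr_cls. Qed.

Lemma lneg_cls a : lneg (clsD a) = clsD (⌟ a).
Proof. apply cls_eq, equiv_lneg, repr_cls. Qed.

(** Replaces quantified elements of the quotient by classes of arbitrary formulae and moves the
    operations inside the classes. *)
Ltac use_representatives :=
  repeat (let q := fresh "q" in intros q; rewrite <- (cls_repr q);
          generalize (proj1_sig q); clear q; intros ?);
  unfold in_cap, in_cup, vee, wedge;
  change (@top lind_sig) with (clsD ⊤); change (@bot lind_sig) with (clsD ⊥);
  repeat rewrite ?cap_cls, ?cup_cls, ?neg_cls, ?lneg_cls.

Lemma lind_is_dBa : is_dBa lind_sig.
Proof.
  constructor; use_representatives; apply cls_eq;
    (* This settles the equations whose two directions are both axioms. Left are the semilattice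
       laws, invariance of the negations under doubling, and absorption. *)
    try (split; apply derives_axiom; constructor; fail).
  - apply (premeet_idem_l premeet_cap).
  - apply equiv_flip, (premeet_idem_l premeet_cup).
  - apply (premeet_comm premeet_cap).
  - apply equiv_flip, (premeet_comm premeet_cup).
  - apply (premeet_assoc premeet_cap).
  - apply equiv_flip, (premeet_assoc premeet_cup).
  - split; [|apply derives_neg]; apply derives_axiom; constructor.
  - split; [apply derives_lneg|]; apply derives_axiom; constructor.
  - apply (premeet_absorb premeet_cap), derives_axiom; constructor.
  - apply equiv_flip, (premeet_absorb premeet_cup), derives_axiom; constructor.
  - apply (premeet_absorb premeet_cap), derives_axiom; constructor.
  - apply equiv_flip, (premeet_absorb premeet_cup), derives_axiom; constructor.
Qed.

Definition lind_dBa : dBa := {| dBa_base := lind_sig; dBa_axioms := lind_is_dBa |}.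

(** [R] cannot contain both components of (Sp), as together they form a provable list; the converse
    directions are projection and injection axioms. *)
Lemma lind_pure (q : lind_dBa) : in_cap q \/ in_cup q.
Proof.
  revert q; use_representatives.
  match goal with |- cls (?a ⊓ ?a) = _ \/ _ =>
    assert (Hsp : derives a (a ⊓ a) \/ derives (a ⊔ a) a) end.
  { apply not_and_or; intros [H1 H2].
    apply (proj1 HR _ (Forall_cons _ H1 (Forall_cons _ H2 (Forall_nil _)))).
    apply r_axiom, HL, ax_PDBL, ax_Sp. }
  destruct Hsp as [H|H]; [left|right]; apply cls_eq; split; try exact H;
    apply derives_axiom; constructor.
Qed.

Definition lind_pdBa : pdBa := {| pdBa_base := lind_dBa; pdBa_pure := lind_pure |}.

Lemma sqle_cls a b : @sqle lind_pdBa (cls a) (cls b) <-> derives a b.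
Proof.
  unfold sqle; cbn -[cap cup cls].
  rewrite !cap_cls, !cup_cls; split.
  - intros [H1 H2]; apply derives_order; now apply equiv_of_cls.
  - intros H; split; apply cls_eq.
    + now apply (premeet_le premeet_cap).
    (* Under the converse order the general law speaks of [b ⊔ a], so the join is commuted first. *)
    + apply equiv_trans with (b ⊔ a); apply equiv_flip;
        [apply (premeet_comm premeet_cup) | now apply (premeet_le premeet_cup)].
Qed.

Definition lindI (q : lind_pdBa) : lind_pdBa := cls (□ proj1_sig q).
Definition lindC (q : lind_pdBa) : lind_pdBa := cls (■ proj1_sig q).

Lemma lindI_cls a : lindI (cls a) = cls (□ a).
Proof. apply cls_eq, equiv_box, repr_cls. Qed.

Lemma lindC_cls a : lindC (cls a) = cls (■ a).
Proof. apply cls_eq, equiv_bbox, repr_cls. Qed.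

Definition lind_pdBao : pdBao.
Proof.
  refine {| pdBao_base := lind_pdBa; opI := lindI; opC := lindC |};
    cbn -[cap cup neg lneg top bot sqle cls];
    use_representatives; rewrite ?lindI_cls, ?lindC_cls, ?cap_cls, ?cup_cls;
    try (apply cls_eq; split; apply derives_modal; constructor; fail).
  - intros H; apply sqle_cls, derives_box; now apply sqle_cls.
  - intros H; apply sqle_cls, derives_bbox; now apply sqle_cls.
Defined.

Definition lind_valuation : valuation lind_pdBao.
Proof.
  refine {| val_OV p := cls (OV p) : lind_pdBao; val_PV P := cls (PV P) : lind_pdBao |};
    intros n; unfold in_cap, in_cup; cbn -[cap cup cls];
    rewrite ?cap_cls, ?cup_cls; apply cls_eq; split; apply derives_axiom; constructor.
Defined.

Lemma eval_lind a : eval lind_valuation a = cls a.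
Proof.
  induction a; cbn [eval]; rewrite ?IHa, ?IHa1, ?IHa2; try reflexivity.
  - apply cap_cls.
  - apply cup_cls.
  - apply neg_cls.
  - apply lneg_cls.
  - apply lindI_cls.
  - apply lindC_cls.
Qed.

(** A satisfied component would be derivable by [sqle_cls], that is, outside [R]. *)
Lemma lind_refutes G : Forall R G -> ~ satisfies lind_valuation G.
Proof.
  unfold satisfies; intros HG Hsat.
  apply Exists_exists in Hsat as ([a b] & Hs & Hsat).
  unfold sat_sequent in Hsat; cbn in Hsat; rewrite !eval_lind in Hsat.
  apply sqle_cls in Hsat; apply Hsat.
  exact (proj1 (Forall_forall _ _) HG _ Hs).
Qed.

Lemma lind_topological : (forall G, MPDBL4 G -> L G) -> topological lind_pdBao.
Proof.
  intros HL4.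
  assert (Hax : forall a b, MPDBL4 [a ⊢ b] -> derives a b)
    by (intros a b H; apply not_refuted_axiom, HL4, H).
  constructor; cbn -[sqle cls]; use_representatives;
    rewrite ?lindI_cls, ?lindC_cls;
    try apply sqle_cls; try (apply cls_eq; split); apply Hax;
    auto using ax_box_T, ax_bbox_T, ax_box_4_1, ax_box_4_2, ax_bbox_4_1, ax_bbox_4_2.
Qed.

End Model.

(** * Completeness and the two equivalences *)

Lemma completeness (K : pdBao -> Prop) L :
  (forall G, MPDBL G -> L G) ->
  (forall (HL : forall G, MPDBL G -> L G) R (HR : maximal_refuted L R),
     K (lind_pdBao L HL R HR)) ->
  forall G, valid_in K G -> provable L G.
Proof.
  intros HL HK G HG; apply NNPP; intros HP.
  destruct (exists_maximal_refuted L G HP) as (R & HR & HRG).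
  (* The only members of [K] that validity is applied to are Lindenbaum algebras of [L]; membership
     is what [HK] provides. *)
  exact (lind_refutes L HL R HR G HRG (HG _ (HK HL R HR) _)).
Qed.

Theorem theorem54 :
  (forall G : hypersequent,
     provable MPDBL G <-> valid_in (fun _ : pdBao => True) G) /\
  (forall G : hypersequent,
     provable MPDBL4 G <-> valid_in topological G).
Proof.
  split; intros G; split.
  - intros HP D _ v; revert G HP; apply provable_sound, MPDBL_sound.
  - now apply completeness.
  - intros HP D HD v; revert G HP; apply provable_sound.
    intros G; now apply MPDBL4_sound.
  - apply completeness; [exact ax_MPDBL|].
    intros HL R HR; now apply lind_topological.
Qed.
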